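(* Let $n,j,k$ be integers with $n\ge 3$ and $1\le j,k<n/2$ and $\gcd(n,j,k)=1$, and let $I(n,j,k)$ be the corresponding $I$-graph. If $I(n,j,k)$ is $[1,\lambda,8]$-cycle regular for some integer $\lambda$, then $I(n,j,k)$ is isomorphic to $I(n',1,k')$ for some \[(n',k')\in \{ (3,1), (4,1),(5,2),(8,3), (10,2),(10,3), (12,5),(13,5),(24,5), (26,5) \}.\]
   Context: For integers $n\ge 3$ and $1\le j,k<n/2$, the $I$-graph $I(n,j,k)$ has vertex set $\{u_0,\dots,u_{n-1},w_0,\dots,w_{n-1}\}$ and edge set consisting of the outer edges $u_iu_{i+j}$, the inner edges $w_iw_{i+k}$ and the spoke edges $u_iw_i$, for $i=0,\dots,n-1$, with subscripts taken modulo $n$. (The condition $\gcd(n,j,k)=1$ is exactly the condition that $I(n,j,k)$ is connected.) For integers $l,\lambda,m$, a simple graph is $[l,\lambda,m]$-cycle regular if every path on $l+1$ vertices belongs to exactly $\lambda$ different cycles of length $m$; in particular $[1,\lambda,8]$-cycle regular means every edge lies on exactly $\lambda$ distinct $8$-cycles. *)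

(* Defs.v *)
(* A simple graph on a finite type of vertices is given by a
   symmetric irreflexive adjacency relation [e : rel V]. *)
From mathcomp Require Import all_boot.

Set Implicit Arguments.
Unset Strict Implicit.
Unset Printing Implicit Defensive.

Definition graph_iso (V W : finType) (e : rel V) (e' : rel W) : Prop :=
  exists2 f : V -> W, bijective f & forall x y : V, e' (f x) (f y) = e x y.

(* The vertex u_i is [inl i] and w_i is [inr i]. *)
Definition igraph (n j k : nat) : rel ('I_n + 'I_n)%type :=
  fun x y =>
    match x, y with
    | inl a, inl b => (b == a + j %[mod n]) || (a == b + j %[mod n])
    | inr a, inr b => (b == a + k %[mod n]) || (a == b + k %[mod n])
    | inl a, inr b => a == b
    | inr a, inl b => a == b
    end.

Arguments igraph : clear implicits.

Lemma igraph_sym n j k : symmetric (igraph n j k).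
Proof. by move=> [a|a] [b|b] //=; rewrite 1?orbC // eq_sym. Qed.

Lemma igraph_irrefl n j k :
  0 < j < n -> 0 < k < n -> irreflexive (igraph n j k).
Proof.
have aux i (a : 'I_n) : 0 < i < n -> (a == a + i %[mod n]) = false.
  case/andP=> i0 lin; rewrite -[X in X == _ %[mod _]]addn0 eqn_modDl mod0n.
  by rewrite modn_small // eq_sym; case: i i0 {lin}.
by move=> jb kb [a|a] /=; rewrite aux.
Qed.

Section CycleRegular.
Variables (V : finType) (e : rel V).

(* Subgraphs are pairs (vertex set, edge set), so that cycles which differ only
   by starting point or orientation are the same cycle. *)
Definition subgraph_of_cycle (c : seq V) : {set V} * {set {set V}} :=
  ([set x in c], [set [set x; next c x] | x in c]).

Definition subgraph_of_path (p : seq V) : {set V} * {set {set V}} :=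
  ([set x in p], [set [set xy.1; xy.2] | xy in zip p (behead p)]).

(* Without [2 < m] a walk x, y, x would be accepted as a cycle of length 2. *)
Definition cycles (m : nat) : {set {set V} * {set {set V}}} :=
  [set subgraph_of_cycle c | c : m.-tuple V & [&& 2 < m, uniq c & cycle e c]].

Definition subgraph (H K : {set V} * {set {set V}}) : bool :=
  (H.1 \subset K.1) && (H.2 \subset K.2).

Definition cycle_regular (l lambda m : nat) : Prop :=
  forall p : l.+1.-tuple V, uniq p -> sorted e p ->
    #|[set C in cycles m | subgraph (subgraph_of_path p) C]| = lambda.

End CycleRegular.

(* Main.v *)
Require Import Defs.
From Stdlib Require Import ZArith Lia.
From mathcomp Require Import all_boot zify ssrZ.

Set Implicit Arguments.
Unset Strict Implicit.
Unset Printing Implicit Defensive.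

(* The graph I(n,j,k) is covered by the graph on bool * Z^2 in which (b, (a, c))
   lies over the vertex of layer b with index a j + c k mod n.  Hence the number
   of 8-cycles through an edge depends only on which short vectors (a, c), of
   1-norm at most 8, belong to the lattice L = {(a, c) | n divides a j + c k}.
   As gcd(n,j,k) = 1, n divides the determinant of any two vectors of L; this
   determinant is at most 64 for short vectors, so for n > 64 the short vectors
   of L are the short multiples of a single vector u.  Running through all u
   shows that the three classes of edges never lie on equally many 8-cycles, and
   the remaining n <= 64 are finitely many.  Every survivor of that enumeration
   is carried to the list by multiplying indices by a unit modulo n, possibly
   after exchanging the two layers. *)

(** * Cycles through an edge *)

Section CyclesThroughEdge.
Variables (V : finType) (e : rel V).
Hypothesis e_sym : symmetric e.

Lemma subgraph_of_cycle_rot (c : seq V) i :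
  uniq c -> subgraph_of_cycle (rot i c) = subgraph_of_cycle c.
Proof.
move=> Uc; congr (_, _); first by apply/setP=> z; rewrite !inE mem_rot.
apply/setP=> A; apply/imsetP/imsetP=> -[z zc ->]; exists z;
  by rewrite ?inE ?mem_rot ?next_rot // in zc *.
Qed.

Lemma subgraph_of_cycle_rev (c : seq V) :
  uniq c -> subgraph_of_cycle (rev c) = subgraph_of_cycle c.
Proof.
move=> Uc; congr (_, _); first by apply/setP=> z; rewrite !inE mem_rev.
apply/setP=> A; apply/imsetP/imsetP=> -[z]; rewrite ?inE ?mem_rev => zc ->.
  by exists (prev c z); rewrite ?mem_prev // next_rev // next_prev // setUC.
exists (next c z); first by rewrite mem_rev mem_next.
by rewrite next_rev // prev_next // setUC.
Qed.

Lemma next_next_neq (c : seq V) a :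
  uniq c -> 2 < size c -> a \in c -> next c (next c a) != a.
Proof.
move=> Uc sc /rot_to[i s Ds].
rewrite -!(next_rot i Uc) Ds.
have: uniq (a :: s) by rewrite -Ds rot_uniq.
have: 2 < size (a :: s) by rewrite -Ds size_rot.
case: s {Ds} => [|b [|d s]] //= _.
rewrite !inE !negb_or eqxx /= => /andP[/and3P[ab ad _] /andP[/andP[bd _] _]].
by rewrite eqxx [b == a]eq_sym (negPf ab) eq_sym.
Qed.

(** The first vertex and the successor map determine the list, so comparing cycles reduces to
    comparing successors. *)
Lemma cycle_traject (T : eqType) (c : seq T) x :
  uniq c -> ohead c = Some x -> c = traject (next c) x (size c).
Proof.
case: c => // y s Uc [<-{x}].
have := cycle_next Uc; rewrite (cycle_path y).
set f := next _ => /= /andP[_ /fpathP[m Ds]].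
by have /(congr1 size) := Ds; rewrite size_traject => ->; rewrite {1}Ds.
Qed.

(** Starting at [y] and ending at [x] fixes both the root and the orientation; the edge from [x] to
    [y] is the closing one. *)
Definition cycles_from (m : nat) (x y : V) : {set m.-tuple V} :=
  [set c : m.-tuple V |
    [&& uniq c, cycle e c, ohead c == Some y & last y c == x]].

Lemma next_last (c : seq V) x y :
  uniq c -> ohead c = Some y -> last y c = x -> next c x = y.
Proof.
case: c => // z s Uc [<-] <-; rewrite [last _ _]/=.
by rewrite next_nth mem_last index_last // nth_default.
Qed.

(** Once start and direction are fixed, the edge set forces each successor in turn: of the two edges
    at a vertex, one leads back and the other leads on. *)
Lemma subgraph_of_cycle_inj (c c' : seq V) x y :
  uniq c -> uniq c' -> 2 < size c -> size c' = size c ->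
  ohead c = Some y -> ohead c' = Some y -> last y c = x -> last y c' = x ->
  subgraph_of_cycle c = subgraph_of_cycle c' -> c = c'.
Proof.
move=> Uc Uc' sc sc' hc hc' lc lc' [Ev Ee].
have E1 z : (z \in c) = (z \in c') by move/setP/(_ z): Ev; rewrite !inE.
have yc : y \in c by case: (c) hc => //= ? ? [->]; rewrite mem_head.
have xc : x \in c by case: (c) hc lc => //= ? ? [->] <-; rewrite mem_last.
have nx := next_last Uc hc lc; have nx' := next_last Uc' hc' lc'.
suff IH i : [/\ iter i (next c) x = iter i (next c') x,
    next c (iter i (next c) x) = next c' (iter i (next c) x)
  & iter i (next c) x \in c].
  rewrite (cycle_traject Uc hc) (cycle_traject Uc' hc') sc'.
  apply: (@eq_from_nth _ y); first by rewrite !size_traject.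
  move=> i; rewrite size_traject => ilt; rewrite !nth_traject //.
  have [E F _] := IH i.
  by rewrite -[in LHS]nx -[in RHS]nx' -!iterSr !iterS F E.
elim: i => [|i [E F ic]] /=; first by rewrite nx nx'.
rewrite -E -F mem_next; split=> //.
set a := iter i _ x in E F ic *; set b := next c a in F *.
have bc : b \in c by rewrite mem_next.
have: [set b; next c' b] \in (subgraph_of_cycle c).2.
  by rewrite /= Ee; apply/imsetP; exists b; rewrite ?inE -?E1.
case/imsetP=> w wc /setP Ew.
(* In [c'] the vertex after [b] is neither its predecessor [a] nor [b] itself. The edge from [b] to
   it also lies in [c], where the only other choice is [next c b]. *)
have nn : next c' b != a by rewrite F next_next_neq ?sc' -?E1.
have nb : next c' b != b.
  have bc' : b \in c' by rewrite -E1.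
  have /= := next_next_neq Uc' _ bc'; rewrite sc' => /(_ sc).
  by apply: contraNneq => E0; rewrite !E0.
have := Ew b; rewrite !inE eqxx /= => /esym/orP[/eqP Dw|/eqP Dw].
  have := Ew (next c' b); rewrite !inE eqxx orbT -Dw => /esym/orP[|/eqP//].
  by rewrite (negPf nb).
have Dwa : w = a by apply: (can_inj (prev_next Uc)); rewrite -Dw.
have := Ew (next c' b); rewrite !inE eqxx orbT => /esym/orP[|].
  by rewrite Dwa (negPf nn).
by rewrite -Dw (negPf nb).
Qed.

(** Every cycle containing the edge is rotated to start at [y], after a reversal if it runs from [y]
    to [x]; injectivity then makes the correspondence one to one. *)
Lemma card_cycles_through_edge m (x y : V) (p : 2.-tuple V) :
  2 < m -> p = [:: x; y] :> seq V -> x != y ->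
  #|[set C in cycles e m | subgraph (subgraph_of_path p) C]|
    = #|cycles_from m x y|.
Proof.
move=> m_gt2 Dp xy.
have inj : {in cycles_from m x y &,
    injective (fun c : m.-tuple V => subgraph_of_cycle c)}.
  move=> c c'; rewrite !inE => /and4P[Uc _ /eqP hc /eqP lc].
  case/and4P=> Uc' _ /eqP hc' /eqP lc' E; apply: val_inj.
  by apply: subgraph_of_cycle_inj E; rewrite ?size_tuple; eauto.
rewrite -(card_in_imset inj); apply: eq_card => C; rewrite inE.
apply/andP/imsetP=> [[/imsetP[c]]|[c]]; last first.
  rewrite inE => /and4P[Uc cc /eqP hc /eqP lc] ->; split.
    by apply/imsetP; exists c => //; rewrite inE m_gt2 Uc.
  have yc : y \in tval c by case: (tval c) hc => //= ? ? [->]; rewrite mem_head.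
  have xc : x \in tval c.
    by case: (tval c) hc lc => //= ? ? [->] <-; rewrite mem_last.
  apply/andP; split; apply/subsetP=> z; rewrite /= Dp.
    by rewrite !inE => /orP[]/eqP->.
  case/imsetP=> -[a b]; rewrite /= inE => /eqP[-> ->] ->.
  by apply/imsetP; exists x => //; rewrite (next_last Uc hc lc).
rewrite inE => /and3P[_ Uc cc] -> /andP[_ /subsetP /= Se].
have {Se} : [set x; y] \in [set [set z; next c z] | z in c].
  by apply: Se; rewrite Dp; apply/imsetP; exists (x, y) => //; apply: mem_head.
have main (d : m.-tuple V) : uniq d -> cycle e d -> y \in tval d ->
    x = prev d y -> exists2 c', c' \in cycles_from m x y &
    subgraph_of_cycle d = subgraph_of_cycle c'.
  move=> Ud cd yd Dx; have [i s Ds] := rot_to yd.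
  exists (rot_tuple i d); last by rewrite /= subgraph_of_cycle_rot.
  rewrite inE /= rot_uniq Ud rot_cycle cd Ds /= eqxx Dx -(prev_rot i Ud) Ds.
  have: uniq (y :: s) by rewrite -Ds rot_uniq.
  rewrite prev_nth mem_head /= => /andP[ys _].
  by rewrite memNindex // -last_nth.
case/imsetP=> z zc /setP E.
have := E x; have := E y; rewrite !inE !eqxx orbT /=.
move=> /esym/orP[]/eqP Dy /esym/orP[]/eqP Dx.
- by rewrite Dx Dy eqxx in xy.
(* Here [c] runs from [y] to [x], so it is reversed first. *)
- have [||||c' c'P] := main (rev_tuple c);
    last by rewrite /= subgraph_of_cycle_rev // => E'; exists c'.
  + by rewrite rev_uniq.
  + by rewrite rev_cycle; under eq_cycle do rewrite e_sym.
  + by rewrite mem_rev Dy.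
  + by rewrite /= prev_rev // Dx Dy.
- have [||||c' c'P E'] := main c => //; last by exists c'.
    by rewrite Dy mem_next.
  by rewrite Dy prev_next.
- by rewrite Dx Dy eqxx in xy.
Qed.
End CyclesThroughEdge.

(** * Counting cycles in the covering graph *)

(** The starting vertex is left out of the listed walks. *)
Fixpoint walks (V : Type) (nb : V -> seq V) m x : seq (seq V) :=
  if m is m'.+1 then flatten [seq [seq y :: p | p <- walks nb m' y] | y <- nb x]
  else [:: [::]].

Lemma walks_map (V W : Type) (h : V -> W) nbV nbW m v :
  (forall v, nbW (h v) = map h (nbV v)) ->
  walks nbW m (h v) = map (map h) (walks nbV m v).
Proof.
move=> nbE; elim: m v => //= m IH v; rewrite nbE map_flatten -!map_comp.
congr flatten; apply: eq_map => y /=.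
by rewrite IH -!map_comp; apply: eq_map.
Qed.

Section Walks.
Variables (V : finType) (e : rel V) (nb : V -> seq V).
Hypothesis nbE : forall x y, e x y = (y \in nb x).
Hypothesis nbU : forall x, uniq (nb x).

Lemma mem_walks m x p : (p \in walks nb m x) = (size p == m) && path e x p.
Proof.
elim: m x p => [|m IH] x p; first by case: p.
apply/flatten_mapP/idP => [[y yx /mapP[q qy ->]]|].
  by move: qy; rewrite IH /= eqSS nbE yx.
case: p => //= y q; rewrite eqSS nbE => /and3P[sq yx yq].
by exists y => //; apply: map_f; rewrite IH sq.
Qed.

Lemma walks_uniq m x : uniq (walks nb m x).
Proof.
elim: m x => //= m IH x; apply: allpairs_uniq_dep => //.
by case=> [y p] [y' p'] _ _ [-> ->].
Qed.

Lemma card_cycles_from m x y : e x y ->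
  #|cycles_from e m.+1 x y|
    = count (fun p => (last y p == x) && uniq (y :: p)) (walks nb m y).
Proof.
move=> exy; rewrite cardE -(size_map val) -size_filter.
rewrite -[RHS](size_map (cons y)).
apply/perm_size/uniq_perm.
- by rewrite (map_inj_uniq val_inj) enum_uniq.
- by rewrite map_inj_uniq ?filter_uniq ?walks_uniq // => p q [].
move=> c; apply/mapP/mapP=> -[d]; rewrite ?mem_enum ?mem_filter ?inE.
  case: d => -[|z p] sd //= /and4P[Up cp /eqP[Dz] lp] ->.
  rewrite {}Dz {z} in sd Up cp lp *; exists p => //.
  rewrite mem_filter lp Up mem_walks -eqSS sd.
  by move: cp; rewrite rcons_path => /andP[].
case/andP=> /andP[/eqP lp Up]; rewrite mem_walks => /andP[sd pd] ->.
exists (Tuple (sd : size (y :: d) == m.+1)) => //.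
by rewrite mem_enum inE Up /= rcons_path pd lp exy !eqxx.
Qed.
End Walks.

Section Cover.

Definition vtx := (bool * (Z * Z))%type.

Definition nbZ (v : vtx) : seq vtx :=
  let: (b, (a, c)) := v in
  if b then [:: (b, (a, c + 1)%Z); (b, (a, c - 1)%Z); (~~ b, (a, c))]
  else [:: (b, (a + 1, c)%Z); (b, (a - 1, c)%Z); (~~ b, (a, c))].

(* Relations are even, so vectors are normalised up to sign to keep the tables
   small. *)
Definition orient (v : Z * Z) : Z * Z :=
  if (v.1 <? 0)%Z || (v.1 =? 0)%Z && (v.2 <? 0)%Z then (- v.1, - v.2)%Z else v.

Definition diff (v w : Z * Z) := orient (v.1 - w.1, v.2 - w.2)%Z.

(** Vertices of different layers never coincide below, so only pairs within a layer contribute. *)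
Fixpoint diffs (s : seq vtx) : seq (Z * Z) :=
  if s is x :: s' then
    [seq diff x.2 y.2 | y <- s' & x.1 == y.1] ++ diffs s'
  else [::].

Definition is0 (v : Z * Z) := (v.1 =? 0)%Z && (v.2 =? 0)%Z.

(* A walk from y over the edge (x, y) with formally distinct vertices yields the
   vector which must vanish for it to end over x, paired with those which must
   not vanish for its vertices to stay distinct below. *)
Definition conditions (x y : vtx) : seq (Z * Z * seq (Z * Z)) :=
  [seq (diff (last y p).2 x.2, diffs (y :: p)) | p <- walks nbZ 7 y &
     ((last y p).1 == x.1) && ~~ has is0 (diffs (y :: p))].

Definition holds (f : pred (Z * Z)) (w : Z * Z * seq (Z * Z)) :=
  f w.1 && ~~ has f w.2.

Variables (W : eqType) (nb : W -> seq W) (f : pred (Z * Z)) (h : vtx -> W).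
Hypothesis f0 : f (0, 0)%Z.
Hypothesis hE : forall v w, (h v == h w) = (v.1 == w.1) && f (diff v.2 w.2).
Hypothesis nbh : forall v, nb (h v) = map h (nbZ v).

Lemma uniq_map_cover s : uniq (map h s) = ~~ has f (diffs s).
Proof.
elim: s => //= v s ->; rewrite has_cat negb_or; congr (~~ _ && _).
elim: s => //= w s IH; rewrite inE IH hE.
by case: eqP.
Qed.

(** The covering map lifts walks uniquely, so the walks below are the images of those above, and end
    point and distinctness become tests on differences. *)
Lemma count_walks_cover x y :
  count (fun p => (last (h y) p == h x) && uniq (h y :: p)) (walks nb 7 (h y))
    = count (holds f) (conditions x y).
Proof.
rewrite (walks_map _ _ nbh) /conditions !count_map count_filter.
apply: eq_count => p /=; rewrite last_map -cons_uniq -map_cons.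
rewrite (uniq_map_cover (y :: p)) hE /holds /=.
set ds := _ ++ _; case: (_ == _) => /=; last by rewrite andbF.
(* A walk that repeats a vertex already in the cover was filtered out of [conditions]; by [f0] it
   also repeats one below. *)
case: (boolP (has is0 _)) => [/= |_]; last by rewrite andbT.
move=> D0; rewrite andbF; apply: negbTE; rewrite negb_and negbK orbC.
apply/orP; left; apply: sub_has D0 => -[a c].
by rewrite /is0 => /andP[/Z.eqb_spec /= -> /Z.eqb_spec /= ->].
Qed.
End Cover.

(** * The I-graph as a quotient of the covering graph *)

Definition relation (n j k : Z) (v : Z * Z) : bool :=
  ((v.1 * j + v.2 * k) mod n =? 0)%Z.

Section IgraphCover.
Variables n j k : nat.
Hypothesis n_gt0 : 0 < n.
Local Notation N := (Z.of_nat n).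
Local Notation J := (Z.of_nat j).
Local Notation K := (Z.of_nat k).
Local Notation f := (relation N J K).

Lemma relationP v : reflect (N | v.1 * J + v.2 * K)%Z (f v).
Proof.
by apply: (iffP (Z.eqb_spec _ _)) => /Z.mod_divide; apply; lia.
Qed.

Lemma relation_orient v : f (orient v) = f v.
Proof.
rewrite /orient; case: ifP => // _; apply/relationP/relationP=> /= -[q Dq];
  by exists (- q)%Z; lia.
Qed.

Lemma residue_subproof z : Z.to_nat (z mod N) < n.
Proof. by have := Z.mod_pos_bound z N; lia. Qed.
Definition residue z : 'I_n := Ordinal (residue_subproof z).

Lemma residue_eq z t : (residue z == residue t) = ((z - t) mod N =? 0)%Z.
Proof.
have n0 : N <> 0%Z by lia.
have := Z.mod_pos_bound z N; have := Z.mod_pos_bound t N.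
rewrite -val_eqE /= => tb zb.
apply/eqP/Z.eqb_spec => [E|/(Z.mod_divide _ _ n0)].
  have {}E : (z mod N = t mod N)%Z by lia.
  by rewrite Zminus_mod E Z.sub_diag Z.mod_0_l.
case=> q Dq; have -> : (z = t + q * N)%Z by lia.
by rewrite Z.mod_add.
Qed.

Lemma residueP z t : reflect (N | z - t)%Z (residue z == residue t).
Proof.
rewrite residue_eq; apply: (iffP (Z.eqb_spec _ _)) => /Z.mod_divide; apply; lia.
Qed.

Lemma residue_nat (a : 'I_n) : residue (Z.of_nat a) = a.
Proof.
apply: val_inj => /=; rewrite Z.mod_small; first by lia.
by have := ltn_ord a; lia.
Qed.

Lemma eqn_residue (a b : nat) :
  (a == b %[mod n]) = (residue (Z.of_nat a) == residue (Z.of_nat b)).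
Proof.
have E c : c %% n = Z.to_nat (Z.of_nat c mod N).
  rewrite -(@Z.mod_unique_pos _ _ (Z.of_nat (c %/ n)) (Z.of_nat (c %% n))).
  - by lia.
  - by have := ltn_pmod c n_gt0; lia.
  - by have := divn_eq c n; nia.
by rewrite !E -val_eqE.
Qed.

Definition neighbours (x : 'I_n + 'I_n) : seq ('I_n + 'I_n) :=
  match x with
  | inl a => [:: inl (residue (Z.of_nat a + J));
                 inl (residue (Z.of_nat a - J)); inr a]
  | inr a => [:: inr (residue (Z.of_nat a + K));
                 inr (residue (Z.of_nat a - K)); inl a]
  end.

Lemma congr_residue (a b : 'I_n) s :
  (b == a + s %[mod n]) || (a == b + s %[mod n])
    = (b \in [:: residue (Z.of_nat a + Z.of_nat s);
                 residue (Z.of_nat a - Z.of_nat s)]).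
Proof.
rewrite !inE !eqn_residue !Nat2Z.inj_add residue_nat; congr (_ || _).
rewrite -{2}[b]residue_nat.
by apply/residueP/residueP=> -[q Dq]; exists (- q)%Z; lia.
Qed.

Lemma igraph_neighbours x y : igraph n j k x y = (y \in neighbours x).
Proof.
case: x y => a [] b; rewrite /= ?congr_residue ?inE /=.
all: by rewrite ?orbF ?orFb // eq_sym.
Qed.

Hypotheses (j_gt0 : 0 < j) (jn : 2 * j < n) (k_gt0 : 0 < k) (kn : 2 * k < n).

Lemma uniq_neighbours x : uniq (neighbours x).
Proof.
have aux (a : Z) s : 0 < s -> 2 * s < n ->
    residue (a + Z.of_nat s) != residue (a - Z.of_nat s).
  move=> s0 sn; apply/negP=> /residueP[q Dq].
  (* [2 * s] lies strictly between 0 and [n], so it is no multiple of [n]. *)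
  have {Dq} : (2 * Z.of_nat s = q * N)%Z by lia.
  by case: (Z.le_gt_cases q 0) => ?; nia.
by case: x => a; rewrite /= !inE !orbF andbT; apply: aux.
Qed.

Definition position (v : Z * Z) := residue (v.1 * J + v.2 * K).

Definition vertex (v : vtx) : 'I_n + 'I_n :=
  if v.1 then inr (position v.2) else inl (position v.2).

Lemma position_eq v w : (position v == position w) = f (diff v w).
Proof.
rewrite /diff relation_orient.
by apply/residueP/relationP=> -[q Dq]; exists q => /=; move: Dq => /=; lia.
Qed.

Lemma vertex_eq v w : (vertex v == vertex w) = (v.1 == w.1) && f (diff v.2 w.2).
Proof. by move: v w => [[] v] [[] w]; rewrite /= -?position_eq. Qed.

Lemma residueD z t : residue (Z.of_nat (residue z) + t) = residue (z + t).
Proof.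
have /residueP[q Dq] : residue (Z.of_nat (residue z)) == residue z.
  by rewrite residue_nat.
by apply/eqP/residueP; exists q; lia.
Qed.

Lemma neighbours_vertex v : neighbours (vertex v) = map vertex (nbZ v).
Proof.
move: v => [[] [a c]]; rewrite /neighbours /vertex /= /position /=;
  congr [:: _; _; _]; rewrite ?residueD;
  by (congr inl || congr inr); congr residue; lia.
Qed.

Lemma count_cycles x y (p : 2.-tuple ('I_n + 'I_n)) :
  igraph n j k (vertex x) (vertex y) -> p = [:: vertex x; vertex y] :> seq _ ->
  #|[set C in cycles (igraph n j k) 8 | subgraph (subgraph_of_path p) C]|
    = count (holds f) (conditions x y).
Proof.
move=> exy Dp; have nE := igraph_neighbours; have nU := uniq_neighbours.
rewrite (card_cycles_through_edge (@igraph_sym n j k) _ Dp) //; last first.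
  by apply: contraTneq exy => ->; rewrite igraph_irrefl //; lia.
rewrite (card_cycles_from nE nU _ exy).
apply: count_walks_cover; first by apply/relationP => //; exists 0%Z.
  exact: vertex_eq.
exact: neighbours_vertex.
Qed.

Lemma cycle_regular_count lambda x y :
  cycle_regular (igraph n j k) 1 lambda 8 ->
  vertex y \in map vertex (nbZ x) ->
  count (holds f) (conditions x y) = lambda.
Proof.
rewrite -neighbours_vertex -igraph_neighbours => reg exy.
pose p := [tuple vertex x; vertex y].
rewrite -(count_cycles exy (erefl : p = [:: vertex x; vertex y] :> seq _)).
apply: reg; rewrite /= ?exy // inE andbT.
by apply: contraTneq exy => ->; rewrite igraph_irrefl //; lia.
Qed.
End IgraphCover.

(** One representative of each class of edges; equality of these three counts is the necessary
    condition extracted from regularity. *)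
Definition outer_edge : vtx * vtx := ((false, (0, 0)), (false, (1, 0)))%Z.
Definition spoke_edge : vtx * vtx := ((false, (0, 0)), (true, (0, 0)))%Z.
Definition inner_edge : vtx * vtx := ((true, (0, 0)), (true, (0, 1)))%Z.

Definition balanced (f : pred (Z * Z)) : Prop :=
  let c xy := count (holds f) (conditions xy.1 xy.2) in
  c outer_edge = c spoke_edge /\ c outer_edge = c inner_edge.

Lemma cycle_regular_balanced n j k lambda :
  0 < j -> 2 * j < n -> 0 < k -> 2 * k < n ->
  cycle_regular (igraph n j k) 1 lambda 8 ->
  balanced (relation (Z.of_nat n) (Z.of_nat j) (Z.of_nat k)).
Proof.
move=> j0 jn k0 kn reg; have n0 : 0 < n by lia.
by split; rewrite !(@cycle_regular_count _ _ _ n0 j0 jn k0 kn _ _ _ reg) //=;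
  rewrite !inE eqxx ?orbT.
Qed.

(** * Tables of closed walks *)

(** Conditions are grouped by closing vector, so that each closing vector is tested once and the
    distinctness tests run only when it is a relation. *)
Definition table := seq ((Z * Z) * seq (seq (Z * Z))).

Fixpoint add_condition (w : (Z * Z) * seq (Z * Z)) (G : table) : table :=
  if G is g :: G' then
    if g.1 == w.1 then (g.1, w.2 :: g.2) :: G' else g :: add_condition w G'
  else [:: (w.1, [:: w.2])].

Definition tabulate (xy : vtx * vtx) : table :=
  foldr add_condition [::] (conditions xy.1 xy.2).

Definition table_count (f : pred (Z * Z)) (G : table) : nat :=
  sumn [seq (if f g.1 then count (fun ds => ~~ has f ds) g.2 else 0) | g <- G].

Lemma table_count_add f w G :
  table_count f (add_condition w G) = holds f w + table_count f G.
Proof.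
case: w => w ds; elim: G => [|[c dss] G IH].
  by rewrite /table_count /holds /=; case: (f w); case: has.
rewrite /=; case: eqP => [->|_]; last first.
  by rewrite /table_count /= -!/(table_count _ _) IH addnCA.
rewrite /table_count /holds /=; case: (f w) => //.
by rewrite addnA.
Qed.

Lemma table_count_tabulate f xy :
  table_count f (tabulate xy) = count (holds f) (conditions xy.1 xy.2).
Proof.
by rewrite /tabulate; elim: conditions => //= w s <-; apply: table_count_add.
Qed.

Definition outer_table := Eval vm_compute in tabulate outer_edge.
Definition spoke_table := Eval vm_compute in tabulate spoke_edge.
Definition inner_table := Eval vm_compute in tabulate inner_edge.

Lemma tablesE :
  [/\ tabulate outer_edge = outer_table, tabulate spoke_edge = spoke_table
     & tabulate inner_edge = inner_table].
Proof. by split; vm_compute. Qed.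

(* Conditionals instead of && avoid evaluating the second argument eagerly. *)
Definition balancedb (f : pred (Z * Z)) : bool :=
  let c := table_count f outer_table in
  if c == table_count f spoke_table then c == table_count f inner_table
  else false.

Lemma balancedP f : reflect (balanced f) (balancedb f).
Proof.
rewrite /balanced -!table_count_tabulate; case: tablesE => -> -> ->.
rewrite /balancedb; apply: (iffP idP) => [|[<- <-]]; last by rewrite eqxx.
by case: eqP => // <- /eqP <-.
Qed.

Definition norm1 (v : Z * Z) : Z := (Z.abs v.1 + Z.abs v.2)%Z.
Definition short (v : Z * Z) : bool := (norm1 v <=? 8)%Z.

(** A cycle has 8 steps, so only short vectors occur in the three tables; this is checked by
    computation. *)
Lemma balancedb_ext f g :
  (forall v, short v -> f v = g v) -> balancedb f = balancedb g.
Proof.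
move=> fg.
have ext G : all (fun g => short g.1 && all (all short) g.2) G ->
    table_count f G = table_count g G.
  elim: G => //= -[c dss] G IH /= /andP[/andP[sc sdss] sG].
  rewrite /table_count /= -!/(table_count _ _) (IH sG) (fg _ sc); congr (_ + _).
  case: (g c) => //=; apply: eq_in_count => ds /(allP sdss) /allP sds.
  by congr (~~ _); apply: eq_in_has => v /sds /fg.
by rewrite /balancedb !ext.
Qed.

(** * Short relations for large n *)

(** For nonzero [u], this says that [v] is an integer multiple of [u]: a parallel [v] equals [u]
    times the quotient of the inner product by the squared length of [u]. *)
Definition on_line (u v : Z * Z) : bool :=
  if (u.1 * v.2 =? u.2 * v.1)%Z then
    ((u.1 * v.1 + u.2 * v.2) mod (u.1 * u.1 + u.2 * u.2) =? 0)%Z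
  else false.

Definition short_vectors : seq (Z * Z) :=
  let range := [seq (Z.of_nat i - 8)%Z | i <- iota 0 17] in
  [seq v <- [seq (a, b) | a <- range, b <- range] | short v].

Lemma mem_short_vectors v : (v \in short_vectors) = short v.
Proof.
rewrite mem_filter andb_idr //; case: v => a b /Z.leb_spec0.
rewrite {1}/norm1 [fst _]/= [snd _]/= => sv.
apply/allpairsP; exists (a, b); split=> //; apply/mapP.
  by exists (Z.to_nat (a + 8)); rewrite ?mem_iota /=; lia.
by exists (Z.to_nat (b + 8)); rewrite ?mem_iota /=; lia.
Qed.

(** Here [a] is [b] times the factor [r / m] in [0, 1); this bounds the remainder in a division by a
    shortest vector. *)
Lemma abs_le_of_scaled (m r a b : Z) : (0 <= r < m -> m * a = r * b ->
  Z.abs a <= Z.abs b /\ (b <> 0 -> Z.abs a < Z.abs b))%Z.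
Proof.
move=> [r0 rm] /(f_equal Z.abs).
rewrite !Z.abs_mul (Z.abs_eq r) // Z.abs_eq; last by lia.
move=> E; split=> [|b0]; first by nia.
have : (0 < Z.abs b)%Z by lia.
by nia.
Qed.

Lemma gcdZ_eq1 n j k : gcdn n (gcdn j k) = 1 ->
  Z.gcd (Z.of_nat n) (Z.gcd (Z.of_nat j) (Z.of_nat k)) = 1%Z.
Proof.
move=> g1; set d := Z.gcd _ _.
have d0 : (0 <= d)%Z by apply: Z.gcd_nonneg.
have dn : (d | Z.of_nat n)%Z by apply: Z.gcd_divide_l.
have djk : (d | Z.gcd (Z.of_nat j) (Z.of_nat k))%Z by apply: Z.gcd_divide_r.
have dj := Z.divide_trans _ _ _ djk (Z.gcd_divide_l _ _).
have dk := Z.divide_trans _ _ _ djk (Z.gcd_divide_r _ _).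
have aux m : (d | Z.of_nat m)%Z -> Z.to_nat d %| m.
  case=> q Dq; apply/dvdnP; exists (Z.to_nat q).
  case: (Z.le_gt_cases 0 q) => ?; first by nia.
  have -> : Z.to_nat q = 0 by lia.
  by nia.
have : Z.to_nat d %| gcdn n (gcdn j k) by rewrite !dvdn_gcd !aux.
by rewrite g1 dvdn1 => /eqP; lia.
Qed.

Section LargeOrder.
Variables n j k : nat.
Hypotheses (n_large : 64 < n) (g1 : gcdn n (gcdn j k) = 1).
Local Notation N := (Z.of_nat n).
Local Notation J := (Z.of_nat j).
Local Notation K := (Z.of_nat k).
Local Notation f := (relation N J K).

Let n_gt0 : 0 < n. Proof. by apply: leq_trans n_large. Qed.

Let fP v : reflect (N | v.1 * J + v.2 * K)%Z (f v).
Proof. exact: relationP. Qed.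

Lemma short_relations_collinear u v :
  short u -> short v -> f u -> f v -> (u.1 * v.2 = u.2 * v.1)%Z.
Proof.
rewrite /short /norm1.
case: u v => [a b] [a' b'] /Z.leb_spec0 /= su /Z.leb_spec0 /= sv.
move=> /fP[q /= Dq] /fP[q' /= Dq'].
set D := (a * b' - b * a')%Z.
(* Cramer's rule: eliminating [K], then [J], from the two relations. *)
have NJ : (N | D * J)%Z by exists (q * b' - q' * b)%Z; nia.
have NK : (N | D * K)%Z by exists (q' * a - q * a')%Z; nia.
have [x [y Exy]] := Z.gcd_bezout _ _ _ (gcdZ_eq1 g1).
have [z [t Ezt]] := Z.gcd_bezout J K _ erefl.
have [r Dr] : (N | D)%Z.
  (* The witness comes from writing 1 as [x * N + y * (z * J + t * K)] and multiplying by [D]. *)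
  case: NJ NK => r Dr [r' Dr']; exists (x * D + y * (z * r + t * r'))%Z.
  rewrite -[LHS]Z.mul_1_r -Exy -Ezt.
  transitivity (D * x * N + y * (z * (D * J) + t * (D * K)))%Z; first ring.
  by rewrite Dr Dr'; ring.
(* The determinant is at most the product of the two 1-norms, hence below [N]. *)
have bD : (Z.abs D <= 64)%Z by rewrite /D; nia.
have r0 : r = 0%Z by nia.
by rewrite r0 /D in Dr; lia.
Qed.

(** If there is a nonzero short relation, take [u] of least norm. Another short relation is parallel
    to [u], and its remainder on division by [u] is a smaller relation, hence zero. *)
Lemma short_relations_line :
  (forall v, short v -> f v = is0 v) \/
  exists u, [/\ short u, ~~ is0 u & forall v, short v -> f v = on_line u v].
Proof.
have f0 v : is0 v -> f v.
  case: v => a b /andP[/Z.eqb_spec /= -> /Z.eqb_spec /= ->].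
  by apply/fP; exists 0%Z.
pose P m :=
  has (fun u => [&& ~~ is0 u, f u & Z.to_nat (norm1 u) <= m]) short_vectors.
have PE u : short u -> ~~ is0 u -> f u -> P (Z.to_nat (norm1 u)).
  by move=> su u0 fu; apply/hasP; exists u;
    rewrite ?mem_short_vectors ?u0 ?fu /=.
case: (boolP (has (fun u => ~~ is0 u && f u) short_vectors)); last first.
  move=> /hasPn no; left=> v sv; apply/idP/idP; last exact: f0.
  move=> fv; apply: contraT => v0.
  by have := no v; rewrite mem_short_vectors v0 fv => /(_ sv).
move=> ex; right.
have {ex} [u [su u0 fu min]] : exists u : Z * Z, [/\ short u, ~~ is0 u, f u &
    forall w, short w -> ~~ is0 w -> f w -> (norm1 u <= norm1 w)%Z].
  have exP : exists m, P m.
    case/hasP: ex => u; rewrite mem_short_vectors => su /andP[u0 fu].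
    by exists (Z.to_nat (norm1 u)); apply: PE.
  case: (ex_minnP exP) => m /hasP[u].
  rewrite mem_short_vectors => su /and3P[u0 fu um] min.
  exists u; split=> // w sw w0 fw; have := min _ (PE w sw w0 fw).
  have : (0 <= norm1 w)%Z by rewrite /norm1; lia.
  by lia.
exists u; split=> // v sv.
have u_gt0 : (0 < u.1 * u.1 + u.2 * u.2)%Z.
  have sqr_gt0 a : a <> 0%Z -> (0 < a * a)%Z by move=> ?; nia.
  have := Z.square_nonneg u.1; have := Z.square_nonneg u.2.
  by move: u0; rewrite negb_and => /orP[]/negbTE/Z.eqb_neq/sqr_gt0; lia.
rewrite /on_line; set uu := (_ + _)%Z in u_gt0 *; set uv := (_ + _)%Z.
(* For parallel vectors, the squared length of [u] times [v] is their inner product times [u]; this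
   avoids fractions. *)
have key : (u.1 * v.2 = u.2 * v.1 ->
    uu * v.1 = uv * u.1 /\ uu * v.2 = uv * u.2)%Z.
  rewrite /uu /uv => col; have := f_equal (Z.mul u.1) col.
  by have := f_equal (Z.mul u.2) col; lia.
apply/idP/idP=> [fv|]; last first.
  case: Z.eqb_spec => // col /Z.eqb_spec; rewrite Z.mod_divide; last by lia.
  case=> q Duv; case/fP: fu => r Dr.
  apply/fP; exists (q * r)%Z.
  have [K1 K2] := key col; rewrite {}Duv in K1 K2.
  have E1 : v.1 = (q * u.1)%Z by apply: (Z.mul_reg_l _ _ uu); lia.
  have E2 : v.2 = (q * u.2)%Z by apply: (Z.mul_reg_l _ _ uu); lia.
  by rewrite E1 E2; have := f_equal (Z.mul q) Dr; lia.
have col := short_relations_collinear su sv fu fv.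
case: Z.eqb_spec => // _; apply/Z.eqb_spec.
set q := (uv / uu)%Z; set r := (uv mod uu)%Z.
have Dr : (uv = uu * q + r)%Z by apply: Z.div_mod; lia.
have rb : (0 <= r < uu)%Z by apply: Z.mod_pos_bound.
(* The remainder [w] is [u] scaled by [r / uu], a factor in [0, 1). *)
pose w := (v.1 - q * u.1, v.2 - q * u.2)%Z.
have [K1 K2] := key col; rewrite {}Dr in K1 K2.
have E1 : (uu * w.1 = r * u.1)%Z by rewrite /w /=; lia.
have E2 : (uu * w.2 = r * u.2)%Z by rewrite /w /=; lia.
have fw : f w.
  case/fP: fu => x Dx; case/fP: fv => y Dy.
  apply/fP; exists (y - q * x)%Z; rewrite /w /=.
  by have := f_equal (Z.mul q) Dx; lia.
have [le1 lt1] := abs_le_of_scaled rb E1.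
have [le2 lt2] := abs_le_of_scaled rb E2.
case: (boolP (is0 w)) => [/andP[/Z.eqb_spec w1 /Z.eqb_spec w2]|w0].
  rewrite w1 in E1; rewrite w2 in E2.
  have : (r * uu = 0)%Z.
    rewrite /uu; have := f_equal (Z.mul u.1) E1.
    by have := f_equal (Z.mul u.2) E2; lia.
  by case/Z.mul_eq_0; lia.
have sw : short w.
  by move: su; rewrite /short /norm1 => /Z.leb_spec0 ?; apply/Z.leb_spec0; lia.
(* A coordinate where [u] is nonzero shrinks strictly, contradicting minimality. *)
have := min w sw w0 fw.
have : (u.1 <> 0 \/ u.2 <> 0)%Z.
  by move: u0; rewrite negb_and => /orP[]/negbTE/Z.eqb_neq; [left | right].
by rewrite /norm1 => -[/lt1 | /lt2]; lia.
Qed.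
End LargeOrder.

(** * Isomorphisms and enumeration *)

(* The excluded lines contain (2,0), (0,2) or (1,1): none of 2j, 2k and j + k
   vanishes modulo n when 2j, 2k < n. *)
Definition unbalanced_line (u : Z * Z) : bool :=
  if is0 u then true else
  if on_line u (2, 0)%Z then true else
  if on_line u (0, 2)%Z then true else
  if on_line u (1, 1)%Z then true else ~~ balancedb (on_line u).

Lemma unbalanced_lines : all unbalanced_line short_vectors.
Proof. by vm_compute. Qed.

Lemma unbalanced_large n j k :
  64 < n -> gcdn n (gcdn j k) = 1 ->
  0 < j -> 2 * j < n -> 0 < k -> 2 * k < n ->
  ~~ balancedb (relation (Z.of_nat n) (Z.of_nat j) (Z.of_nat k)).
Proof.
move=> n_large g1 j0 jn k0 kn.
case: (short_relations_line n_large g1) => [f0 | [u [su u0 fu]]].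
  by rewrite (balancedb_ext f0); vm_compute.
rewrite (balancedb_ext fu).
have n0 : 0 < n by lia.
(* Values strictly between 0 and [n] are not divisible by [n]; this rules out the three excluded
   kinds of line. *)
have small (v : Z * Z) : short v ->
    (0 < v.1 * Z.of_nat j + v.2 * Z.of_nat k < Z.of_nat n)%Z ->
    on_line u v = false.
  move=> sv b; rewrite -fu //; apply/negP=> /(relationP j k n0)[q Dq].
  by case: (Z.le_gt_cases q 0) => ?; nia.
have := allP unbalanced_lines u; rewrite mem_short_vectors => /(_ su).
by rewrite /unbalanced_line (negPf u0) !small //; cbn [fst snd]; lia.
Qed.

(** * Isomorphisms given by unit multipliers *)

(** Congruence up to sign, since steps [j] and [-j] give the same edges. *)
Definition congr_pm n a b : bool :=
  if a %% n == b %% n then true else (a + b) %% n == 0.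

(** A unit multiplier preserves and reflects congruence; when it sends [j] to [-j'], the two
    disjuncts trade places. *)
Lemma congr_pm_step n g j j' a b : coprime n g -> congr_pm n (g * j) j' ->
  (g * b == g * a + j' %[mod n]) || (g * a == g * b + j' %[mod n])
    = (b == a + j %[mod n]) || (a == b + j %[mod n]).
Proof.
move=> cg.
have mulE x y : (g * x == g * y %[mod n]) = (x == y %[mod n]).
  wlog xy : x y / x <= y => [th|].
    case: (leqP x y) => [/th //|/ltnW/th].
    by rewrite eq_sym => ->; rewrite eq_sym.
  by rewrite eq_sym [RHS]eq_sym !eqn_mod_dvd ?leq_mul // -mulnBr Gauss_dvdr.
rewrite /congr_pm; case: eqP => [E _|_ /eqP E].
  by rewrite -!(modnDmr _ j') -E !modnDmr -!mulnDr !mulE.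
have swap x y : (g * x == g * y + j' %[mod n]) = (y == x + j %[mod n]).
  rewrite -(mulE y) mulnDr -(eqn_modDr (g * j) (g * x)) -addnA [j' + _]addnC.
  by rewrite -(modnDmr _ (_ + j')) E addn0 eq_sym.
by rewrite !swap orbC.
Qed.

Lemma igraph_swap n j k : graph_iso (igraph n j k) (igraph n k j).
Proof.
pose h (x : 'I_n + 'I_n) := match x with inl a => inr a | inr a => inl a end.
by exists h; [exists h; case | case=> a [] b].
Qed.

Lemma graph_iso_trans (U V W : finType) (e : rel U) (e' : rel V) (e'' : rel W) :
  graph_iso e e' -> graph_iso e' e'' -> graph_iso e e''.
Proof.
move=> [f bf fE] [g bg gE]; exists (g \o f); first exact: bij_comp.
by move=> x y /=; rewrite gE fE.
Qed.

Lemma igraph_mul n g j k j' k' : 0 < n -> coprime n g ->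
  congr_pm n (g * j) j' -> congr_pm n (g * k) k' ->
  graph_iso (igraph n j k) (igraph n j' k').
Proof.
move=> n0 cg jj kk.
pose m (a : 'I_n) : 'I_n := Ordinal (ltn_pmod (g * a) n0).
have mE (a b : 'I_n) s s' : congr_pm n (g * s) s' ->
    (m b == m a + s' %[mod n]) || (m a == m b + s' %[mod n])
      = (b == a + s %[mod n]) || (a == b + s %[mod n]).
  by move=> /(congr_pm_step a b cg) <-; rewrite /= !modn_mod !modnDml.
have m_inj : injective m.
  move=> a b /(congr1 val) /= E; apply: val_inj => /=.
  (* With both steps zero, adjacency is congruence modulo [n], so the lemma yields injectivity. *)
  have := @congr_pm_step n g 0 0 a b cg.
  rewrite muln0 /congr_pm eqxx !addn0 !(eq_sym (g * b %% n)) E eqxx /=.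
  move=> /(_ isT) /esym; rewrite eq_sym orbb => /eqP.
  by rewrite !modn_small.
pose h (x : 'I_n + 'I_n) :=
  match x with inl a => inl (m a) | inr a => inr (m a) end.
exists h.
  apply: injF_bij => -[a|a] [b|b] //= [] E; congr (_ _);
    by apply: m_inj; apply: val_inj.
by case=> a [] b; rewrite /= ?(mE _ _ _ _ jj) ?(mE _ _ _ _ kk) //
  (inj_eq m_inj).
Qed.

(** * Enumeration of the cases up to 64 *)

Definition classification : seq (nat * nat) :=
  [:: (3, 1); (4, 1); (5, 2); (8, 3); (10, 2); (10, 3);
      (12, 5); (13, 5); (24, 5); (26, 5)].

Definition equivalent_by n j k k' g : bool :=
  if coprime n g then
    if congr_pm n (g * j) 1 then congr_pm n (g * k) k' else false
  else false.

Definition classified n j k : bool :=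
  has (fun nk => if nk.1 == n then
      has (fun g => equivalent_by n j k nk.2 g || equivalent_by n k j nk.2 g)
        (iota 0 n)
    else false) classification.

Lemma classifiedP n j k : 0 < n -> classified n j k ->
  exists n' k', (n', k') \in classification /\
    graph_iso (igraph n j k) (igraph n' 1 k').
Proof.
move=> n0 /hasP[[n' k'] nk]; rewrite /=; case: eqP => // En' /hasP[g _] E.
exists n, k'; split; first by rewrite -En'.
have mul j1 k1 : equivalent_by n j1 k1 k' g ->
    graph_iso (igraph n j1 k1) (igraph n 1 k').
  rewrite /equivalent_by; case: ifP => // cg; case: ifP => // jj kk.
  exact: igraph_mul cg jj kk.
case/orP: E => /mul //; exact: graph_iso_trans (igraph_swap n j k).
Qed.

Definition small_check n j k : bool :=
  if gcdn n (gcdn j k) == 1 then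
    if balancedb (relation (Z.of_nat n) (Z.of_nat j) (Z.of_nat k))
    then classified n j k else true
  else true.

(** The range is 3 to 64 for [n], and [(uphalf n).-1] is the largest [j] with [2 * j < n]. *)
Lemma small_checks :
  all (fun n => let s := iota 1 (uphalf n).-1 in
    all (fun j => all (small_check n j) s) s) (iota 3 62).
Proof. by vm_compute. Qed.

Theorem theorem1 (n j k : nat) (hn : 3 <= n)
    (hj : 1 <= j) (hjn : 2 * j < n) (hk : 1 <= k) (hkn : 2 * k < n)
    (hgcd : gcdn n (gcdn j k) = 1)
    (hreg : exists lambda : nat, cycle_regular (igraph n j k) 1 lambda 8) :
  exists n' k' : nat,
    (n', k') \in [:: (3, 1); (4, 1); (5, 2); (8, 3); (10, 2); (10, 3);
                     (12, 5); (13, 5); (24, 5); (26, 5)] /\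
    graph_iso (igraph n j k) (igraph n' 1 k').
Proof.
case: hreg => lambda /(cycle_regular_balanced hj hjn hk hkn)/balancedP bal.
have n_small : n <= 64.
  by rewrite leqNgt; apply: contraL bal => /unbalanced_large; apply.
apply: classifiedP; first by lia.
have n_in : n \in iota 3 62 by rewrite mem_iota; lia.
have j_in : j \in iota 1 (uphalf n).-1 by rewrite mem_iota; lia.
have k_in : k \in iota 1 (uphalf n).-1 by rewrite mem_iota; lia.
have /allP/(_ _ j_in)/allP/(_ _ k_in) := allP small_checks n n_in.
by rewrite /small_check hgcd eqxx bal.
Qed.
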